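(* Let $\mathbb{K}$ be a field and suppose that a tensor $T \in \mathbb{K}^{m \times n \times p}$ has a matrix-vector decomposition $T=\sum_{\ell=1}^q M_{\ell} \otimes w_{\ell}$ in which the linear subspaces $\operatorname{Im}(M_1),\dots,\operatorname{Im}(M_q)$ of $\mathbb{K}^m$ are in direct sum and the linear subspaces $\operatorname{Im}(M_1^T),\dots,\operatorname{Im}(M_q^T)$ of $\mathbb{K}^n$ are also in direct sum. Then $\operatorname{rank}(T)=\sum_{\ell = 1}^q \operatorname{rank}(M_{\ell})$, and this is the unique matrix-vector decomposition of $T$ of minimum rank.
   Context: For a matrix $M\in M_{m,n}(\mathbb{K})$ and $w\in\mathbb{K}^p$, $M\otimes w$ is the tensor with entries $M_{ij}w_k$. The rank of a tensor is the least number of nonzero tensors of the form $u\otimes v\otimes w$ (entries $u_iv_jw_k$) summing to it. A matrix-vector decomposition of $T$ is an expression $T=\sum_{\ell=1}^q M_\ell\otimes w_\ell$ with all $M_\ell$ nonzero, all $w_\ell$ nonzero, and no two of the vectors $w_\ell$ colinear; its rank is $\sum_{\ell}\operatorname{rank}(M_\ell)$. Uniqueness means: up to permutation, the terms $M_\ell\otimes w_\ell$ are the same in all matrix-vector decompositions of $T$ of minimum rank. *)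

(* Defs.v *)
From mathcomp Require Import all_boot all_order all_algebra.

Set Implicit Arguments.
Unset Strict Implicit.
Unset Printing Implicit Defensive.

Import GRing.Theory.
Local Open Scope ring_scope.

Notation tensor K m n p := {ffun 'I_m * 'I_n * 'I_p -> K}.

Definition mvtens (K : fieldType) (m n p : nat)
    (M : 'M[K]_(m, n)) (w : 'cV[K]_p) : tensor K m n p :=
  [ffun x => M x.1.1 x.1.2 * w x.2 0].

Definition vtens (K : fieldType) (m n p : nat)
    (u : 'cV[K]_m) (v : 'cV[K]_n) (w : 'cV[K]_p) : tensor K m n p :=
  [ffun x => u x.1.1 0 * v x.1.2 0 * w x.2 0].

Definition sum_of_simple (K : fieldType) (m n p : nat)
    (T : tensor K m n p) (r : nat) : Prop :=
  exists (u : 'I_r -> 'cV[K]_m) (v : 'I_r -> 'cV[K]_n) (w : 'I_r -> 'cV[K]_p),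
    (forall l, vtens (u l) (v l) (w l) != 0)
    /\ T = \sum_(l < r) vtens (u l) (v l) (w l).

(* A relation rather than a function: over a general field, being a sum of r
   simple tensors is not a decidable property. *)
Definition is_tensor_rank (K : fieldType) (m n p : nat)
    (T : tensor K m n p) (r : nat) : Prop :=
  sum_of_simple T r /\ forall s, sum_of_simple T s -> (r <= s)%N.

Definition colinear (K : fieldType) (p : nat) (w w' : 'cV[K]_p) : Prop :=
  exists a b : K, (a, b) != (0, 0) /\ a *: w + b *: w' = 0.

Definition mv_decomposition (K : fieldType) (m n p : nat) (T : tensor K m n p)
    (q : nat) (M : 'I_q -> 'M[K]_(m, n)) (w : 'I_q -> 'cV[K]_p) : Prop :=
  [/\ T = \sum_(l < q) mvtens (M l) (w l),
      forall l, M l != 0,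
      forall l, w l != 0
    & forall l l', l != l' -> ~ colinear (w l) (w l')].

Definition mv_rank (K : fieldType) (m n q : nat)
    (M : 'I_q -> 'M[K]_(m, n)) : nat :=
  (\sum_(l < q) \rank (M l))%N.

Definition min_mv_decomposition (K : fieldType) (m n p : nat)
    (T : tensor K m n p)
    (q : nat) (M : 'I_q -> 'M[K]_(m, n)) (w : 'I_q -> 'cV[K]_p) : Prop :=
  mv_decomposition T M w /\
  forall (q' : nat) (M' : 'I_q' -> 'M[K]_(m, n)) (w' : 'I_q' -> 'cV[K]_p),
    mv_decomposition T M' w' -> (mv_rank M <= mv_rank M')%N.

Definition mv_terms (K : fieldType) (m n p q : nat)
    (M : 'I_q -> 'M[K]_(m, n)) (w : 'I_q -> 'cV[K]_p) : seq (tensor K m n p) :=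
  [seq mvtens (M l) (w l) | l : 'I_q].

Definition unique_min_mv_decomposition (K : fieldType) (m n p : nat)
    (T : tensor K m n p)
    (q : nat) (M : 'I_q -> 'M[K]_(m, n)) (w : 'I_q -> 'cV[K]_p) : Prop :=
  min_mv_decomposition T M w /\
  forall (q' : nat) (M' : 'I_q' -> 'M[K]_(m, n)) (w' : 'I_q' -> 'cV[K]_p),
    min_mv_decomposition T M' w' -> perm_eq (mv_terms M' w') (mv_terms M w).

(* M acts on column vectors; the row space of M used by mxalgebra is thus
   the image of M^T, not of M. *)
Definition mximage (K : fieldType) (m n : nat) (M : 'M[K]_(m, n)) :
    {vspace 'cV[K]_m} :=
  limg (linfun (mulmx M : 'cV[K]_n -> 'cV[K]_m)).

(* Main.v *)
(* View T through its slices S_k = sum_l w_l[k] M_l.  Since the images of the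
   M_l are in direct sum, projections yield matrices L_l with L_l M_l = M_l and
   L_l M_j = 0 for j != l; then L_l S_k = w_l[k] M_l, so the row space of M_l is
   contained in the sum of the row spaces of the matrices of any other
   decomposition of T.  As the row spaces of the M_l are in direct sum, this
   bounds below the rank of any decomposition, into simple tensors or into
   matrix-vector terms.
   When a second decomposition (M'_j, w'_j) reaches the bound, its row spaces
   are in direct sum too, so matrices R_j isolate its terms on the right, and
   w_l[k] M_l R_j = L_l S_k R_j = w'_j[k] L_l M'_j.  If M_l R_j != 0, then w_l
   and w'_j are colinear; by non-colinearity each l is matched with exactly one
   j and conversely, and M_l = M_l R_j and M'_j = L_l M'_j for matched l, j. *)

Require Import Defs.
From mathcomp Require Import all_boot all_order all_algebra.

Set Implicit Arguments.
Unset Strict Implicit.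
Unset Printing Implicit Defensive.

Import GRing.Theory.
Local Open Scope ring_scope.

(** * Direct sums of row spaces and separating matrices *)

Lemma directv_mxdirect_trmx (K : fieldType) (m n q : nat)
    (M : 'I_q -> 'M[K]_(m, n)) :
  directv (\sum_(l < q) mximage (M l))%VS ->
  mxdirect (\sum_(l < q) <<(M l)^T>>)%MS.
Proof.
move/directv_sum_independent=> indep.
have im_mem l (x : 'cV_n) : M l *m x \in mximage (M l).
  have -> : M l *m x = linfun (mulmx (M l) : 'cV_n -> 'cV_m) x by rewrite lfunE.
  by rewrite memv_img ?memvf.
apply/mxdirect_sumsP=> l _; apply/eqP; rewrite -submx0; apply/rV_subP=> v.
rewrite sub_capmx genmxE => /andP[/submxP[x def_v] /sub_sumsmxP[y v_sum]].
have y_row j : exists z, y j *m <<(M j)^T>>%MS = z *m (M j)^T.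
  by apply/submxP; rewrite (submx_trans (submxMl _ _)) ?genmxE.
have [z def_z] := fin_all_exists y_row.
(* Transposing the two expressions of [v] and subtracting gives a vanishing sum of vectors [us j] of
   the images, whose [l]-th vector is [v^T]; independence kills it. *)
pose us j := M j *m (if j == l then x^T else - (z j)^T).
have us0 : \sum_j us j = 0.
  apply: trmx_inj; rewrite trmx0 linear_sum /= (bigD1 l) //= /us eqxx trmx_mul.
  rewrite trmxK -def_v v_sum -big_split /= big1 // => j jl.
  by rewrite (negPf jl) trmx_mul linearN /= trmxK mulNmx def_z subrr.
have := indep us (fun j _ => im_mem j _) us0 l isT.
rewrite /us eqxx => /(congr1 trmx); rewrite trmx_mul trmxK trmx0 -def_v => ->.
exact: sub0mx.
Qed.

Lemma mxdirect_separating (K : fieldType) (m n q : nat)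
    (A : 'I_q -> 'M[K]_(m, n)) :
  mxdirect (\sum_(l < q) <<A l>>)%MS ->
  exists R : 'I_q -> 'M[K]_n,
    forall l j, A l *m R j = if l == j then A l else 0.
Proof.
move/mxdirect_sumsP=> dxA.
(* [R j] projects onto the row space of [A j] along the sum of the others. *)
exists (fun j => proj_mx <<A j>>%MS (\sum_(i < q | i != j) <<A i>>)%MS) => l j.
have dxj := dxA j isT.
case: eqP => [->|/eqP lj]; first by rewrite proj_mx_id ?genmxE.
by rewrite proj_mx_0 // (sumsmx_sup l) ?genmxE.
Qed.

Lemma mxdirect_separating_col (K : fieldType) (m n q : nat)
    (A : 'I_q -> 'M[K]_(m, n)) :
  mxdirect (\sum_(l < q) <<(A l)^T>>)%MS ->
  exists L : 'I_q -> 'M[K]_m,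
    forall l j, L j *m A l = if l == j then A l else 0.
Proof.
move=> /mxdirect_separating[R sepR]; exists (fun j => (R j)^T) => l j.
by apply: trmx_inj; rewrite trmx_mul trmxK sepR; case: ifP; rewrite ?trmx0.
Qed.

(** The row vectors fixed by [\sum_j R j] form the kernel of [\sum_j R j - 1], a subspace that
    contains the row space of every [A l], hence their sum. *)
Lemma separating_sum (K : fieldType) (m m' n q : nat)
    (A : 'I_q -> 'M[K]_(m, n)) (R : 'I_q -> 'M[K]_n) (B : 'M[K]_(m', n)) :
  (forall l j, A l *m R j = if l == j then A l else 0) ->
  (B <= \sum_(l < q) <<A l>>)%MS -> B *m (\sum_j R j) = B.
Proof.
move=> sepR sBA; have: (B <= kermx (\sum_j R j - 1%:M))%MS.
  apply: submx_trans sBA _; apply/sumsmx_subP=> l _.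
  rewrite genmxE; apply/sub_kermxP; rewrite mulmxBr mulmx1 mulmx_sumr.
  by rewrite (bigD1 l) //= sepR eqxx big1 ?addr0 ?subrr // => j jl;
     rewrite sepR eq_sym (negPf jl).
by move/sub_kermxP/eqP; rewrite mulmxBr mulmx1 subr_eq0 => /eqP.
Qed.

Lemma rank_genmx_sum_le (K : fieldType) (m n q : nat)
    (A : 'I_q -> 'M[K]_(m, n)) :
  (\rank (\sum_(l < q) <<A l>>)%MS <= \sum_(l < q) \rank (A l))%N.
Proof.
apply: leq_trans (mxrank_sum_leqif _).1 _ => /=.
by apply: leq_sum => l _; rewrite genmxE.
Qed.

Lemma mxdirect_rank_genmx (K : fieldType) (m n q : nat)
    (A : 'I_q -> 'M[K]_(m, n)) :
  mxdirect (\sum_(l < q) <<A l>>)%MS =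
    (\rank (\sum_(l < q) <<A l>>)%MS == \sum_(l < q) \rank (A l))%N.
Proof.
rewrite mxdirectE /=; congr (_ == _); apply: eq_bigr => l _.
by rewrite genmxE.
Qed.

(** * Slices of a tensor *)

Lemma mvtens_sumE (K : fieldType) (m n p q : nat)
    (M : 'I_q -> 'M[K]_(m, n)) (w : 'I_q -> 'cV[K]_p) i j k :
  (\sum_l mvtens (M l) (w l)) (i, j, k) = (\sum_l w l k 0 *: M l) i j.
Proof.
by rewrite sum_ffunE summxE; apply: eq_bigr => l _; rewrite ffunE mxE mulrC.
Qed.

Lemma mxdirect_genmx_trmxK (K : fieldType) (m n q : nat)
    (A : 'I_q -> 'M[K]_(m, n)) :
  mxdirect (\sum_(l < q) <<((A l)^T)^T>>)%MS =
    mxdirect (\sum_(l < q) <<A l>>)%MS.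
Proof.
rewrite !mxdirect_rank_genmx; congr (\rank _ == _);
  by apply: eq_bigr => l _; rewrite trmxK.
Qed.

Section TwoDecompositions.

Variables (K : fieldType) (m n p q q' : nat).
Variables (M : 'I_q -> 'M[K]_(m, n)) (w : 'I_q -> 'cV[K]_p).
Variables (M' : 'I_q' -> 'M[K]_(m, n)) (w' : 'I_q' -> 'cV[K]_p).

Lemma eq_slices :
  \sum_l mvtens (M l) (w l) = \sum_l mvtens (M' l) (w' l) ->
  forall k, \sum_l w l k 0 *: M l = \sum_l w' l k 0 *: M' l.
Proof.
move=> eqT k; apply/matrixP=> i j.
by rewrite -!mvtens_sumE eqT.
Qed.

Hypothesis eqS : forall k, \sum_l w l k 0 *: M l = \sum_l w' l k 0 *: M' l.

Lemma separating_slice (L : 'I_q -> 'M[K]_m) l k :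
  (forall l j, L j *m M l = if l == j then M l else 0) ->
  L l *m (\sum_j w j k 0 *: M j) = w l k 0 *: M l.
Proof.
move=> sepL; rewrite mulmx_sumr (bigD1 l) //= -scalemxAr sepL eqxx.
by rewrite big1 ?addr0 // => j jl; rewrite -scalemxAr sepL (negPf jl) scaler0.
Qed.

Lemma row_sub_of_direct_col l :
  mxdirect (\sum_(j < q) <<(M j)^T>>)%MS -> w l != 0 ->
  (M l <= \sum_(j < q') <<M' j>>)%MS.
Proof.
(* A coordinate [k] where [w l] is nonzero makes [M l] a left multiple of the [k]-th slice, up to a
   nonzero scalar; left multiplication does not enlarge row spaces. *)
move=> /mxdirect_separating_col[L sepL] /cV0Pn[k wk].
rewrite -(eqmx_scale _ wk) -(separating_slice _ _ sepL) eqS.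
apply: submx_trans (submxMl _ _) _; apply: summx_sub => j _.
by rewrite scalemx_sub // (sumsmx_sup j) ?genmxE.
Qed.

End TwoDecompositions.

Lemma scale_trmx_slices (K : fieldType) (m n p q : nat)
    (M : 'I_q -> 'M[K]_(m, n)) (w : 'I_q -> 'cV[K]_p) k :
  (\sum_l w l k 0 *: M l)^T = \sum_l w l k 0 *: (M l)^T.
Proof. by rewrite linear_sum; apply: eq_bigr => l _; rewrite /= linearZ. Qed.

(** * From matrix-vector terms to simple tensors *)

Lemma mvtens_sum (K : fieldType) (m n p r : nat)
    (A : 'I_r -> 'M[K]_(m, n)) (w : 'cV[K]_p) :
  mvtens (\sum_l A l) w = \sum_l mvtens (A l) w.
Proof.
apply/ffunP=> x; rewrite sum_ffunE ffunE summxE mulr_suml.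
by apply: eq_bigr => l _; rewrite ffunE.
Qed.

Lemma vtensE (K : fieldType) (m n p : nat)
    (u : 'cV[K]_m) (v : 'cV[K]_n) (w : 'cV[K]_p) :
  vtens u v w = mvtens (u *m v^T) w.
Proof. by apply/ffunP=> x; rewrite !ffunE !mxE big_ord1 mxE. Qed.

Lemma vtens_neq0 (K : fieldType) (m n p : nat)
    (u : 'cV[K]_m) (v : 'cV[K]_n) (w : 'cV[K]_p) :
  u != 0 -> v != 0 -> w != 0 -> vtens u v w != 0.
Proof.
move=> /cV0Pn[i ui] /cV0Pn[j vj] /cV0Pn[k wk].
apply/eqP=> /ffunP/(_ (i, j, k))/eqP; rewrite !ffunE /=.
by rewrite !mulf_eq0 (negPf ui) (negPf vj) (negPf wk).
Qed.

Lemma row_free_row_neq0 (K : fieldType) (m n : nat) (A : 'M[K]_(m, n)) i :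
  row_free A -> row i A != 0.
Proof.
move=> freeA; apply/eqP; rewrite rowE -(mul0mx _ A) => /(row_free_inj freeA).
move/matrixP/(_ 0 i)/eqP; rewrite !mxE !eqxx; exact/negP/oner_neq0.
Qed.

(** A rank factorization of [M] writes it as a sum of products of a column of [col_base M] with a
    row of [row_base M]; these columns and rows are independent, hence nonzero. *)
Lemma sum_of_simple_mvtens (K : fieldType) (m n p : nat)
    (M : 'M[K]_(m, n)) (w : 'cV[K]_p) :
  w != 0 -> sum_of_simple (mvtens M w) (\rank M).
Proof.
move=> w0; pose C := col_base M; pose R := row_base M.
exists (fun l => col l C), (fun l => (row l R)^T), (fun _ => w); split=> [l|].
  apply: vtens_neq0 => //.
    rewrite -trmx_eq0 tr_col row_free_row_neq0 //.
    by rewrite /row_free mxrank_tr; apply: col_base_full.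
  by rewrite trmx_eq0 row_free_row_neq0 // row_base_free.
under eq_bigr do rewrite vtensE trmxK.
rewrite -mvtens_sum; congr mvtens.
rewrite -[LHS]mulmx_base; apply/matrixP=> i j; rewrite mxE summxE.
by apply: eq_bigr => l _; rewrite !mxE big_ord1 !mxE.
Qed.

Lemma sum_of_simpleD (K : fieldType) (m n p : nat) (T T' : tensor K m n p)
    r r' :
  sum_of_simple T r -> sum_of_simple T' r' -> sum_of_simple (T + T') (r + r').
Proof.
move=> [u [v [w [nz ->]]]] [u' [v' [w' [nz' ->]]]].
pose glue k (a : 'I_r -> 'cV[K]_k) (b : 'I_r' -> 'cV[K]_k) (l : 'I_(r + r')) :=
  match split l with inl i => a i | inr i => b i end.
exists (glue m u u'), (glue n v v'), (glue p w w'); split=> [l|].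
  by rewrite /glue; case: (split l).
rewrite big_split_ord /=; congr (_ + _); apply: eq_bigr => l _.
  by rewrite /glue (unsplitK (inl l)).
by rewrite /glue (unsplitK (inr l)).
Qed.

Lemma sum_of_simple_mv_decomposition (K : fieldType) (m n p q : nat)
    (T : tensor K m n p) (M : 'I_q -> 'M[K]_(m, n)) (w : 'I_q -> 'cV[K]_p) :
  mv_decomposition T M w -> sum_of_simple T (mv_rank M).
Proof.
case=> -> _ w0 _; rewrite /mv_rank.
elim/big_rec2: _ => [|l r T' _ IH].
  by exists (fun=> 0), (fun=> 0), (fun=> 0); split; [case | rewrite big_ord0].
exact: sum_of_simpleD (sum_of_simple_mvtens _ _) IH.
Qed.

(** * Proportional vectors and distinct terms *)

Lemma proportional_of_scale (K : fieldType) (m n p : nat)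
    (X Y : 'M[K]_(m, n)) (v v' : 'cV[K]_p) :
  X != 0 -> v != 0 -> (forall k, v k 0 *: X = v' k 0 *: Y) ->
  exists2 c : K, c != 0 & v = c *: v'.
Proof.
(* Comparing both sides at a nonzero entry of [X] gives the factor. *)
move=> /matrix0Pn[i [j x0]] v0 eqXY.
have def_v : v = (Y i j / X i j) *: v'.
  apply/colP=> k; have /matrixP/(_ i j) := eqXY k; rewrite !mxE => eqk.
  by apply: (mulIf x0); rewrite eqk mulrAC divfK // mulrC.
exists (Y i j / X i j) => //.
by apply: contraNneq v0 => c0; rewrite def_v c0 scale0r.
Qed.

Lemma colinear_of_left (K : fieldType) (p : nat) (v v1 v2 : 'cV[K]_p) c1 c2 :
  c1 != 0 -> v = c1 *: v1 -> v = c2 *: v2 -> colinear v1 v2.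
Proof.
move=> c10 def1 def2; exists c1, (- c2); rewrite xpair_eqE negb_and c10.
by rewrite -def1 scaleNr -def2 subrr.
Qed.

Lemma colinear_of_right (K : fieldType) (p : nat) (v v1 v2 : 'cV[K]_p) c1 c2 :
  c2 != 0 -> v1 = c1 *: v -> v2 = c2 *: v -> colinear v1 v2.
Proof.
move=> c20 -> ->; exists c2, (- c1); rewrite xpair_eqE negb_and c20; split=> //.
by rewrite !scalerA -scalerDl mulNr mulrC subrr scale0r.
Qed.

(** Equal terms would have proportional vectors. Without repetitions, two lists of terms are
    permutations of each other as soon as they have the same elements. *)
Lemma mv_terms_uniq (K : fieldType) (m n p q : nat) (T : tensor K m n p)
    (M : 'I_q -> 'M[K]_(m, n)) (w : 'I_q -> 'cV[K]_p) :
  mv_decomposition T M w -> uniq (mv_terms M w).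
Proof.
case=> _ M0 w0 ncol; rewrite map_inj_uniq ?enum_uniq // => l j eq_lj.
apply/eqP/negPn/negP => lj; apply: (ncol l j lj).
have scal k : w l k 0 *: M l = w j k 0 *: M j.
  apply/matrixP=> a b; have /ffunP/(_ (a, b, k)) := eq_lj.
  by rewrite !ffunE /= !mxE mulrC => ->; rewrite mulrC.
have [c c0 def_w] := proportional_of_scale (M0 l) (w0 l) scal.
by apply: (colinear_of_left (oner_neq0 K) _ def_w); rewrite scale1r.
Qed.

(** * The lower bound on ranks and its equality case *)

Section RankBound.

Variables (K : fieldType) (m n p q q' : nat).
Variables (M : 'I_q -> 'M[K]_(m, n)) (w : 'I_q -> 'cV[K]_p).
Variables (M' : 'I_q' -> 'M[K]_(m, n)) (w' : 'I_q' -> 'cV[K]_p).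
Hypothesis eqT : \sum_l mvtens (M l) (w l) = \sum_l mvtens (M' l) (w' l).
Hypothesis w0 : forall l, w l != 0.
Hypothesis direct_col : mxdirect (\sum_(l < q) <<(M l)^T>>)%MS.
Hypothesis direct_row : mxdirect (\sum_(l < q) <<M l>>)%MS.

Let sMM' : (\sum_(l < q) <<M l>> <= \sum_(j < q') <<M' j>>)%MS.
Proof.
apply/sumsmx_subP=> l _; rewrite genmxE.
exact: (row_sub_of_direct_col (eq_slices eqT)).
Qed.

Let rank_sum_le : (mv_rank M <= \rank (\sum_(j < q') <<M' j>>)%MS)%N.
Proof.
move: direct_row; rewrite mxdirect_rank_genmx /mv_rank => /eqP <-.
exact: mxrankS.
Qed.

(** The vectors [w'] may vanish or be colinear here, so the bound also covers sums of simple
    tensors. *)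
Lemma mv_rank_le_of_direct : (mv_rank M <= mv_rank M')%N.
Proof. exact: leq_trans rank_sum_le (rank_genmx_sum_le _). Qed.

(** The dimension of the sum of the row spaces of the [M' j] lies between [mv_rank M] and
    [mv_rank M']; when it reaches the latter, the sum is direct. *)
Lemma direct_row_of_mv_rank_le :
  (mv_rank M' <= mv_rank M)%N -> mxdirect (\sum_(j < q') <<M' j>>)%MS.
Proof.
move=> le_rank; rewrite mxdirect_rank_genmx eqn_leq rank_genmx_sum_le.
exact: leq_trans le_rank rank_sum_le.
Qed.

(** The inclusion [sMM'] becomes an equality, by dimension. *)
Lemma row_sub_of_mv_rank_le j :
  (mv_rank M' <= mv_rank M)%N -> (M' j <= \sum_(l < q) <<M l>>)%MS.
Proof.
move=> le_rank.
have sM'M : (\sum_(j < q') <<M' j>> <= \sum_(l < q) <<M l>>)%MS.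
  rewrite -(mxrank_leqif_sup sMM') eqn_leq mxrankS //=.
  apply: leq_trans (rank_genmx_sum_le _) _; apply: leq_trans le_rank _.
  by move: direct_row; rewrite mxdirect_rank_genmx => /eqP->.
by apply: submx_trans sM'M; rewrite (sumsmx_sup j) ?genmxE.
Qed.

End RankBound.

Lemma mvtens_trmx_eq (K : fieldType) (m n p q q' : nat)
    (M : 'I_q -> 'M[K]_(m, n)) (w : 'I_q -> 'cV[K]_p)
    (M' : 'I_q' -> 'M[K]_(m, n)) (w' : 'I_q' -> 'cV[K]_p) :
  \sum_l mvtens (M l) (w l) = \sum_l mvtens (M' l) (w' l) ->
  \sum_l mvtens (M l)^T (w l) = \sum_l mvtens (M' l)^T (w' l).
Proof.
move=> eqT; apply/ffunP=> -[[i j] k].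
by rewrite !mvtens_sumE -!scale_trmx_slices (eq_slices eqT).
Qed.

Lemma mv_rank_trmx (K : fieldType) (m n q : nat) (M : 'I_q -> 'M[K]_(m, n)) :
  mv_rank (fun l => (M l)^T) = mv_rank M.
Proof. by apply: eq_bigr => l _; rewrite mxrank_tr. Qed.

(** * Matching the terms of two minimal decompositions *)

Section Uniqueness.

Variables (K : fieldType) (m n p q q' : nat) (T : tensor K m n p).
Variables (M : 'I_q -> 'M[K]_(m, n)) (w : 'I_q -> 'cV[K]_p).
Variables (M' : 'I_q' -> 'M[K]_(m, n)) (w' : 'I_q' -> 'cV[K]_p).
Hypotheses (dec : mv_decomposition T M w) (dec' : mv_decomposition T M' w').
Hypothesis direct_col : mxdirect (\sum_(l < q) <<(M l)^T>>)%MS.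
Hypothesis direct_row : mxdirect (\sum_(l < q) <<M l>>)%MS.
Hypothesis le_rank : (mv_rank M' <= mv_rank M)%N.

Let eqT : \sum_l mvtens (M l) (w l) = \sum_l mvtens (M' l) (w' l).
Proof. by case: dec dec' => <- _ _ _ [<-]. Qed.

Let w0 l : w l != 0. Proof. by case: dec. Qed.
Let w'0 j : w' j != 0. Proof. by case: dec'. Qed.

Let row_sub l : (M l <= \sum_(j < q') <<M' j>>)%MS.
Proof. exact: (row_sub_of_direct_col (eq_slices eqT)). Qed.

(** This is the equality case for the transposed families, where the two directness hypotheses trade
    places. *)
Let col_sub j : ((M' j)^T <= \sum_(l < q) <<(M l)^T>>)%MS.
Proof.
apply: (row_sub_of_mv_rank_le (mvtens_trmx_eq eqT) w0) => //.
  by rewrite mxdirect_genmx_trmxK.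
by rewrite !mv_rank_trmx.
Qed.

Lemma perm_mv_terms : perm_eq (mv_terms M' w') (mv_terms M w).
Proof.
have [L sepL] := mxdirect_separating_col direct_col.
have [R sepR] := mxdirect_separating
  (direct_row_of_mv_rank_le eqT w0 direct_col direct_row le_rank).
have M_sum l : \sum_j M l *m R j = M l.
  by rewrite -mulmx_sumr (separating_sum sepR).
have M'_sum j : \sum_l L l *m M' j = M' j.
  apply: trmx_inj; rewrite -mulmx_suml trmx_mul linear_sum /=.
  apply: separating_sum (col_sub j) => l i.
  by rewrite -trmx_mul sepL; case: ifP; rewrite ?trmx0.
have cross l j k : w l k 0 *: (M l *m R j) = w' j k 0 *: (L l *m M' j).
  rewrite scalemxAl -(separating_slice _ _ _ sepL) (eq_slices eqT) -mulmxA.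
  rewrite mulmx_suml (bigD1 j) //= -scalemxAl sepR eqxx big1 ?addr0 => [|i ij].
    by rewrite -scalemxAr.
  by rewrite -scalemxAl sepR (negPf ij) scaler0.
have matched_prop l j :
    M l *m R j != 0 -> exists2 c : K, c != 0 & w l = c *: w' j.
  by move=> ne0; apply: proportional_of_scale ne0 (w0 l) (cross l j).
have matched_sym l j : L l *m M' j != 0 -> M l *m R j != 0.
  move=> ne0; apply: contraNneq ne0 => eq0.
  have /cV0Pn[k w'k] := w'0 j; have /esym/eqP := cross l j k.
  by rewrite eq0 scaler0 scaler_eq0 (negPf w'k).
have matched l j : M l *m R j != 0 -> mvtens (M l) (w l) = mvtens (M' j) (w' j).
  move=> ne0; have [c c0 def_w] := matched_prop l j ne0.
  (* A second nonzero summand [M l *m R i] would make [w' i] and [w' j] both proportional to [w l],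
     hence colinear. *)
  have -> : M l = M l *m R j.
    rewrite -[LHS]M_sum (bigD1 j) //= big1 ?addr0 // => i ij.
    apply/eqP/negPn/negP=> /matched_prop[c' _ def_w'].
    case: dec' => _ _ _ /(_ j i); rewrite eq_sym ij; apply=> //.
    exact: colinear_of_left c0 def_w def_w'.
  have -> : M' j = L l *m M' j.
    rewrite -[LHS]M'_sum (bigD1 l) //= big1 ?addr0 // => i il.
    apply/eqP/negPn/negP=> /matched_sym/matched_prop[c' _ def_w'].
    case: dec => _ _ _ /(_ i l il); apply.
    exact: colinear_of_right c0 def_w' def_w.
  apply/ffunP=> -[[a b] k]; rewrite !ffunE /=.
  have /matrixP/(_ a b) := cross l j k.
  by rewrite mxE [RHS]mxE mulrC => ->; rewrite mulrC.
apply: uniq_perm; rewrite ?(mv_terms_uniq dec) ?(mv_terms_uniq dec') // => t.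
apply/mapP/mapP=> -[i _ ->].
  (* Some summand of [M'_sum] is nonzero because [M' i] is, so every term finds a match. *)
  have [l ne0|all0] := pickP (fun l => L l *m M' i != 0).
    by exists l; rewrite ?mem_enum // (matched l i) ?matched_sym.
  case: dec' => _ /(_ i)/eqP[]; rewrite -M'_sum big1 // => l _.
  by apply/eqP/negPn; rewrite all0.
have [j ne0|all0] := pickP (fun j => M i *m R j != 0).
  by exists j; rewrite ?mem_enum // (matched i j).
case: dec => _ /(_ i)/eqP[]; rewrite -M_sum big1 // => j _.
by apply/eqP/negPn; rewrite all0.
Qed.

End Uniqueness.

Theorem theorem1p4 (K : fieldType) (m n p : nat) (T : tensor K m n p)
    (q : nat) (M : 'I_q -> 'M[K]_(m, n)) (w : 'I_q -> 'cV[K]_p)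
    (dec : mv_decomposition T M w)
    (direct_im : directv (\sum_(l < q) mximage (M l))%VS)
    (direct_imT : directv (\sum_(l < q) mximage (M l)^T)%VS) :
  is_tensor_rank T (\sum_(l < q) \rank (M l))%N
  /\ unique_min_mv_decomposition T M w.
Proof.
have direct_col := directv_mxdirect_trmx direct_im.
have direct_row : mxdirect (\sum_(l < q) <<M l>>)%MS.
  by rewrite -mxdirect_genmx_trmxK; apply: directv_mxdirect_trmx.
have [defT _ w0 _] := dec.
have min_dec : min_mv_decomposition T M w.
  split=> // q' M' w' [defT' _ _ _].
  have eqT : \sum_l mvtens (M l) (w l) = \sum_l mvtens (M' l) (w' l).
    by rewrite -defT -defT'.
  exact: mv_rank_le_of_direct eqT w0 direct_col direct_row.
split; last first.
  split=> // q' M' w' [dec' min'].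
  exact: perm_mv_terms dec dec' direct_col direct_row (min' _ _ _ dec).
split; first exact: sum_of_simple_mv_decomposition dec.
move=> s [u [v [z [_ defT']]]].
(* Each [M' l] has rank at most 1, so [mv_rank M'] is at most [s]. *)
pose M' l := u l *m (v l)^T.
have eqT : \sum_l mvtens (M l) (w l) = \sum_l mvtens (M' l) (z l).
  by rewrite -defT defT'; apply: eq_bigr => l _; rewrite vtensE.
apply: leq_trans (mv_rank_le_of_direct eqT w0 direct_col direct_row) _.
rewrite -[s in (_ <= s)%N]card_ord -sum1_card; apply: leq_sum => l _.
exact: leq_trans (mxrankM_maxl _ _) (rank_leq_col _).
Qed.
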